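(* Let $(W,S)$ be any Coxeter system and let $w,x\in W$. The shifted lower interval $[e,w]\,x^{-1}=\{vx^{-1}: v\le w\}$, partially ordered by the restriction of the Bruhat order of $W$, has a unique minimum and a unique maximum: $$\min\bigl([e,w]\,x^{-1}\bigr) = \bigl(x \mathbin{\bar\star} w^{-1}\bigr)^{-1}\qquad\text{and}\qquad \max\bigl([e,w]\,x^{-1}\bigr)= w\star x^{-1}.$$
   Context: $(W,S)$ is a Coxeter system (not assumed finite) with identity $e$, length function $\ell$ and Bruhat order $\le$. Demazure product: $\star$ is the associative product on the set $W$ with identity $e$ (the Coxeter monoid, generated by $S$ subject to the braid relations and $s\star s=s$ for $s\in S$) which satisfies, for $s\in S$ and $w\in W$, $s\star w=w$ if $\ell(sw)<\ell(w)$ and $s\star w=sw$ if $\ell(sw)>\ell(w)$. Opposite Demazure operator: for $u\in W$ and $s\in S$, let $u\mathbin{\bar\star}s=u$ if $\ell(us)>\ell(u)$ and $u\mathbin{\bar\star}s=us$ if $\ell(us)<\ell(u)$. For a word $\sigma=s_1\cdots s_k$ in the alphabet $S$, let $u\mathbin{\bar\star}\sigma=(((u\mathbin{\bar\star}s_1)\mathbin{\bar\star}s_2)\cdots\mathbin{\bar\star}s_k)$. For $w\in W$, $u\mathbin{\bar\star}w$ means $u\mathbin{\bar\star}\sigma$ for $\sigma$ a reduced word of $w$ (the result does not depend on the choice of reduced word). ''Minimum'' (resp. ''maximum'') means an element that is $\le$ (resp. $\ge$) every element of the set. *)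

(* Defs.v *)
From Stdlib Require Import Relation_Operators.
From mathcomp Require Import all_boot.
From mathcomp Require Import boolp classical_sets.

Set Implicit Arguments.
Unset Strict Implicit.
Unset Printing Implicit Defensive.

Local Open Scope classical_set_scope.
Local Open Scope group_scope.

(* Coxeter matrices are functions m to nat, where the value 0 encodes an
   infinite label, i.e. the absence of a relation; this is consistent with
   [x ^+ 0 = 1].  Only the values on S * S matter. *)
Definition coxeter_matrix (W : Type) (S : set W) (m : W -> W -> nat) : Prop :=
  forall s t, S s -> S t -> m s t = m t s /\ (m s t = 1%N <-> s = t).

Definition coxeter_relations (W : Type) (S : set W) (m : W -> W -> nat)
    (G : groupType) (f : W -> G) : Prop :=
  forall s t, S s -> S t -> (f s * f t) ^+ m s t = 1.

Definition word_for (W : groupType) (S : set W) (w : W) (sigma : seq W) : Prop :=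
  (forall s, s \in sigma -> S s) /\ \prod_(s <- sigma) s = w.

(* W is the group presented by the generators S and the relations
   (st)^m(s,t) = 1, expressed by the universal property of presentations.
   Inverses are not needed for generation, since m(s,s) = 1 gives s^2 = 1. *)
Definition coxeter_system (W : groupType) (S : set W) : Prop :=
  exists m : W -> W -> nat,
    [/\ coxeter_matrix S m,
        coxeter_relations S m (fun s : W => s),
        (forall w : W, exists sigma, word_for S w sigma)
      & forall (G : groupType) (f : W -> G), coxeter_relations S m f ->
          exists phi : {multiplicative W -> G}, forall s, S s -> phi s = f s].

Definition reduced_word (W : groupType) (S : set W) (w : W) (sigma : seq W)
    : Prop :=
  word_for S w sigma /\
  forall tau, word_for S w tau -> (size sigma <= size tau)%N.

(* All reduced words of w have the same size; the default value is only
   taken when w is not a product of elements of S. *)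
Definition coxeter_length (W : groupType) (S : set W) (w : W) : nat :=
  xget 0%N [set n | exists2 sigma, reduced_word S w sigma & size sigma = n].

Definition reflection (W : groupType) (S : set W) (t : W) : Prop :=
  exists s g : W, S s /\ t = g * s * g^-1.

Definition bruhat_step (W : groupType) (S : set W) (u v : W) : Prop :=
  (exists2 t, reflection S t & v = u * t) /\
  (coxeter_length S u < coxeter_length S v)%N.

Definition bruhat (W : groupType) (S : set W) : W -> W -> Prop :=
  clos_refl_trans W (bruhat_step S).

Definition is_minimum (W : groupType) (S A : set W) (a : W) : Prop :=
  A a /\ forall b, A b -> bruhat S a b.

Definition is_maximum (W : groupType) (S A : set W) (a : W) : Prop :=
  A a /\ forall b, A b -> bruhat S b a.

Definition is_demazure (W : groupType) (S : set W) (star : W -> W -> W)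
    : Prop :=
  [/\ associative star, left_id 1 star, right_id 1 star
    & forall s w, S s ->
      ((coxeter_length S (s * w) < coxeter_length S w)%N -> star s w = w) /\
      ((coxeter_length S w < coxeter_length S (s * w))%N -> star s w = s * w)].

(* For a Coxeter system there is exactly one such product: if s_1 ... s_k is a
   reduced word of w, then w star x = s_1 star (... star (s_k star x)). *)
Definition demazure (W : groupType) (S : set W) : W -> W -> W :=
  xget (fun u v : W => u * v) [set star | is_demazure S star].

(* In a Coxeter system the lengths of u and us always differ. *)
Definition op_demazure_gen (W : groupType) (S : set W) (u s : W) : W :=
  if (coxeter_length S (u * s) < coxeter_length S u)%N then u * s else u.

Definition op_demazure_word (W : groupType) (S : set W) (u : W)
    (sigma : seq W) : W :=
  foldl (op_demazure_gen S) u sigma.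

(* The common value on all reduced words of w. *)
Definition op_demazure (W : groupType) (S : set W) (u w : W) : W :=
  xget u [set v | forall sigma, reduced_word S w sigma ->
                    op_demazure_word S u sigma = v].

Definition shifted_lower_interval (W : groupType) (S : set W) (w x : W)
    : set W :=
  [set v * x^-1 | v in [set v | bruhat S v w]].

(* Main.v *)
Require Import Defs.
From HB Require Import structures.
From mathcomp Require Import all_boot.
From mathcomp Require Import boolp classical_sets.
From Stdlib Require Import Relation_Operators.

(** Fix [s] in [S] and let [raise s u], resp. [lower s u], be the longer, resp.
    the shorter, of [u] and [s * u].  Both operators preserve the Bruhat order
    ([raise_lower_homo]).  Hence, if [s * w] is longer than [w], an element [v]
    lies below [s * w] if and only if [v] or [s * v] lies below [w]: apply
    [lower s] to [v <= s * w] in one direction and [raise s] in the other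
    ([lower_interval_mul]).  In other words [[e, s * w] = [e, w] U s [e, w]],
    and so, writing [A] for [[e, w] * x^-1],
    [[e, s * w] * x^-1 = A U s A].  If [a] is the minimum of [A] then
    [lower s a] belongs to [A U s A] and, by monotonicity, lies below every
    [lower s b] with [b] in [A], hence below [b] and [s * b]; it is the minimum
    of [A U s A].  Dually [raise s] sends the maximum of [A] to the maximum of
    [A U s A].  By induction on a reduced word [s_1 ... s_k] of [w], the two
    extrema of [[e, w] * x^-1] are obtained from [x^-1] by applying
    [lower s_k, ..., lower s_1], resp. [raise s_k, ..., raise s_1]
    ([shifted_minimum], [shifted_maximum]).  The first is the inverse of
    [x] acted upon by the opposite Demazure operators of the word
    [s_k ... s_1] of [w^-1], the second is the Demazure product of [w] and
    [x^-1].

    The Demazure product and the opposite operator are introduced by a choice,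
    so that their existence has to be established.  The extrema do it:
    they are characterised without reference to a word, hence the iterated
    operators depend only on [w], and
    [u, v |-> max ([e, u] * v)] is an associative product with the required
    values on generators ([is_demazure_interval_max]).

    Monotonicity rests on the fact that left multiplication by [s] preserves
    the relation [u < t * u], for every reflection [t] other than [s] itself
    ([reflection_length_gen]).  To see this one needs the inversion sets
    [N w = {t | t * w is shorter than w}] and their cocycle identity
    [N (u * v) = N u + u (N v) u^-1] (symmetric difference).  The cocycle is
    built first, from the universal property of the presentation: the elements
    [({s}, s)] of the semidirect product of the group of subsets of [W] by [W]
    satisfy the Coxeter relations, and [N w] is the first component of the
    image of [w] ([inversion_cocycle]). *)

Set Implicit Arguments.
Unset Strict Implicit.

Local Open Scope group_scope.

(** * The inversion cocycle *)

(** Pairs of a subset of [W], given by its indicator, and an element of [W]: the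
    carrier of the semidirect product of (subsets, symmetric difference) by [W]
    acting by conjugation. *)
Definition subset_semidirect (W : groupType) : Type := ((W -> bool) * W)%type.

HB.instance Definition _ (W : groupType) := gen_eqMixin (subset_semidirect W).
HB.instance Definition _ (W : groupType) :=
  gen_choiceMixin (subset_semidirect W).

Definition subset_semidirect_mul (W : groupType) (a b : subset_semidirect W) :
  subset_semidirect W := (fun r => a.1 r (+) b.1 (r ^ a.2), a.2 * b.2).
Definition subset_semidirect_one (W : groupType) : subset_semidirect W :=
  (fun => false, 1).
Definition subset_semidirect_inv (W : groupType) (a : subset_semidirect W) :
  subset_semidirect W := (fun r => a.1 (r ^ a.2^-1), a.2^-1).

Lemma subset_semidirect_mulA (W : groupType) :
  associative (@subset_semidirect_mul W).
Proof.
move=> a b c; rewrite /subset_semidirect_mul /= mulgA; congr pair.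
by apply/funext => r; rewrite conjgM addbA.
Qed.

Lemma subset_semidirect_mul1g (W : groupType) :
  left_id (subset_semidirect_one W) (@subset_semidirect_mul W).
Proof.
case=> a u; rewrite /subset_semidirect_mul /= mul1g; congr pair.
by apply/funext => r; rewrite conjg1.
Qed.

Lemma subset_semidirect_mulg1 (W : groupType) :
  right_id (subset_semidirect_one W) (@subset_semidirect_mul W).
Proof.
case=> a u; rewrite /subset_semidirect_mul /= mulg1; congr pair.
by apply/funext => r; rewrite addbF.
Qed.

Lemma subset_semidirect_mulVg (W : groupType) :
  left_inverse (subset_semidirect_one W) (@subset_semidirect_inv W)
    (@subset_semidirect_mul W).
Proof.
case=> a u; rewrite /subset_semidirect_mul /= mulVg; congr pair.
by apply/funext => r; rewrite addbb.
Qed.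

Lemma subset_semidirect_mulgV (W : groupType) :
  right_inverse (subset_semidirect_one W) (@subset_semidirect_inv W)
    (@subset_semidirect_mul W).
Proof.
case=> a u; rewrite /subset_semidirect_mul /= mulgV; congr pair.
by apply/funext => r; rewrite conjgK addbb.
Qed.

HB.instance Definition _ (W : groupType) :=
  isGroup.Build (subset_semidirect W) (@subset_semidirect_mulA W)
    (@subset_semidirect_mul1g W) (@subset_semidirect_mulg1 W)
    (@subset_semidirect_mulVg W) (@subset_semidirect_mulgV W).

Definition semidirect_gen (W : groupType) (s : W) : subset_semidirect W :=
  (fun r => r == s, s).

Lemma dihedral_expV (W : groupType) (s t : W) (k : nat) :
  s * s = 1 -> t * t = 1 -> s * (s * t) ^- k = (s * t) ^+ k * s.
Proof.
move=> /mulg1_eq sV /mulg1_eq tV.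
have inv_st : (s * t) ^ s = (s * t)^-1.
  by rewrite invgM sV tV conjgE sV mulgA -{1}sV mulKg.
by rewrite -expVgn -inv_st -conjXg conjgE sV -{1}sV mulKg.
Qed.

(** The subset component lists the [k.*2] elements [(st)^j s] of the dihedral
    group generated by [s] and [t]; when [(st)^k = 1] this list runs twice
    through the same [k] elements, so that its sum vanishes. *)
Lemma semidirect_gen_power (W : groupType) (s t : W) (k : nat) :
  s * s = 1 -> t * t = 1 ->
  (semidirect_gen s * semidirect_gen t) ^+ k =
    (fun r => \big[addb/false]_(j < k.*2) (r == (s * t) ^+ j * s),
     (s * t) ^+ k) :> subset_semidirect W.
Proof.
move=> s2 t2; have sV := mulg1_eq s2.
elim: k => [|k IHk].
  by rewrite !expg0; congr pair; apply/funext => r; rewrite big_ord0.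
rewrite expgSr IHk; congr pair; last by rewrite expgSr.
apply/funext => r /=; rewrite doubleS !big_ord_recr /= -addbA.
congr (_ (+) (_ (+) _)).
  rewrite (can2_eq (conjgK _) (conjgKV _)) conjgE invgK dihedral_expV //.
  by rewrite mulgA -expgnDr addnn.
rewrite -conjgM (can2_eq (conjgK _) (conjgKV _)) invgM conjgM !conjgE sV invgK.
have -> : s^-1 * (t * s) / (s * t) ^+ k = s * t * (s * (s * t) ^- k).
  by rewrite sV !mulgA.
by rewrite dihedral_expV // -addnn -addSn expgnDr expgSr !mulgA.
Qed.

Lemma coxeter_gen_invol (W : groupType) (S : set W) (s : W) :
  coxeter_system S -> S s -> s * s = 1.
Proof.
move=> [m [mP rel _ _]] Ss; have [_ [_ /(_ erefl) m1]] := mP s s Ss Ss.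
by have := rel s s Ss Ss; rewrite m1 expg1.
Qed.

(** Writing [N w] for the subset component of the image of [w], the second
    equation is the multiplication law of the semidirect product, since the
    other component of the image of [w] is [w] itself. *)
Lemma inversion_cocycle (W : groupType) (S : set W) :
  coxeter_system S ->
  exists N : W -> W -> bool,
    (forall s r, S s -> N s r = (r == s)) /\
    (forall u v r, N (u * v) r = N u r (+) N v (r ^ u)).
Proof.
move=> cox; have invol := coxeter_gen_invol cox.
have [m [mP rel gen univ]] := cox.
have [|phi phiE] := univ (subset_semidirect W) (@semidirect_gen W).
  move=> s t Ss St; rewrite semidirect_gen_power ?invol // rel //.
  congr pair; apply/funext => r; rewrite -addnn big_split_ord /=.
  under [X in _ (+) X]eq_bigr do rewrite expgnDr rel // mul1g.
  by rewrite addbb.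
have phi1 : phi 1 = 1 by apply: (@mulgI _ (phi 1)); rewrite -gmulfM !mulg1.
have phi2 w : (phi w).2 = w.
  have [sigma [Ssig <-]] := gen w; elim: sigma Ssig => [|s sigma IH] Ssig.
    by rewrite big_nil phi1.
  rewrite big_cons gmulfM /= IH; last first.
    by move=> r rs; apply: Ssig; rewrite inE rs orbT.
  by rewrite phiE //; apply: Ssig; rewrite inE eqxx.
exists (fun w => (phi w).1); split=> [s r Ss|u v r]; first by rewrite phiE.
by rewrite gmulfM /= phi2.
Qed.

(** * Words and length *)

Section CoxeterSystem.

Variables (W : groupType) (S : set W).
Hypothesis cox : coxeter_system S.

Local Notation len := (coxeter_length S).

Let invol s : S s -> s * s = 1 := coxeter_gen_invol cox.
Let genV s (Ss : S s) : s^-1 = s := mulg1_eq (invol Ss).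

Lemma gen_mulK s : S s -> cancel (fun w => s * w) (fun w => s * w).
Proof. by move=> Ss w; rewrite mulgA invol ?mul1g. Qed.

Lemma word_for_cons s v sigma :
  word_for S (s * v) (s :: sigma) <-> S s /\ word_for S v sigma.
Proof.
split=> [[Ssig]|[Ss [Ssig <-]]].
  rewrite big_cons => /mulgI vE; split; first by apply: Ssig; rewrite inE eqxx.
  by split=> // r rs; apply: Ssig; rewrite inE rs orbT.
by split=> [r|]; rewrite ?big_cons // inE => /predU1P [->|/Ssig].
Qed.

Lemma word_for_nil w : word_for S w [::] <-> w = 1.
Proof. by split=> [[_]|->]; [rewrite big_nil|split=> //; rewrite big_nil]. Qed.

Lemma word_for_rev w sigma : word_for S w sigma -> word_for S w^-1 (rev sigma).
Proof.
move=> [Ssig <-]; split=> [s|]; first by rewrite mem_rev; apply: Ssig.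
rewrite -{2}(revK sigma) -prodgV; apply: eq_big_seq => s.
by rewrite mem_rev => /Ssig Ss; rewrite genV.
Qed.

Lemma reduced_word_exists w : exists sigma, reduced_word S w sigma.
Proof.
have [_ [_ _ /(_ w) [sigma0 w0] _]] := cox.
have ex_size :
    exists n, `[< exists2 sigma, word_for S w sigma & size sigma = n >].
  by exists (size sigma0); apply/asboolP; exists sigma0.
have [n /asboolP [sigma wsig sizen] nmin] := ex_minnP ex_size.
exists sigma; split=> // tau wtau; rewrite sizen; apply: nmin.
by apply/asboolP; exists tau.
Qed.

Lemma reduced_word_length w sigma :
  reduced_word S w sigma -> len w = size sigma.
Proof.
move=> red; apply: xget_unique => [|_ [tau [wtau tau_min] <-]].
  by exists sigma.
have [wsig sig_min] := red.
by apply/eqP; rewrite eqn_leq tau_min // sig_min.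
Qed.

Lemma length_le_word w sigma : word_for S w sigma -> (len w <= size sigma)%N.
Proof.
have [tau red] := reduced_word_exists w.
by rewrite (reduced_word_length red); apply: red.2.
Qed.

Lemma length1 : len 1 = 0%N.
Proof.
apply/eqP; rewrite -leqn0 (@length_le_word 1 [::]) //; exact/word_for_nil.
Qed.

Lemma reduced_word_rev w sigma :
  reduced_word S w sigma -> reduced_word S w^-1 (rev sigma).
Proof.
move=> [wsig sig_min]; split=> [|tau /word_for_rev]; first exact: word_for_rev.
by rewrite invgK size_rev -(size_rev tau); apply: sig_min.
Qed.

Lemma lengthV w : len w^-1 = len w.
Proof.
have [sigma red] := reduced_word_exists w.
have redV := reduced_word_rev red.
by rewrite (reduced_word_length red) (reduced_word_length redV) size_rev.
Qed.

Lemma reduced_word_cons s v sigma : S s -> (len v < len (s * v))%N ->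
  reduced_word S v sigma -> reduced_word S (s * v) (s :: sigma).
Proof.
move=> Ss lt_v red; split=> [|tau /length_le_word].
  exact/word_for_cons/(conj Ss red.1).
by apply: leq_trans; rewrite /= -(reduced_word_length red).
Qed.

(** A suffix of a reduced word is reduced, so properties of reduced words can be
    proved by adding letters on the left, each of which increases the length. *)
Lemma reduced_word_ind (P : W -> seq W -> Prop) :
  P 1 [::] ->
  (forall s v sigma, S s -> (len v < len (s * v))%N -> reduced_word S v sigma ->
     P v sigma -> P (s * v) (s :: sigma)) ->
  forall w sigma, reduced_word S w sigma -> P w sigma.
Proof.
move=> P1 PS w sigma; elim: sigma w => [|s sigma IH] w red.
  by have /word_for_nil -> := red.1.
have wE : w = s * (s^-1 * w) by rewrite mulVKg.
move: (red); rewrite wE => -[/word_for_cons [Ss vsig] sig_min].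
have redv : reduced_word S (s^-1 * w) sigma.
  split=> // tau vtau; suff: (size (s :: sigma) <= size (s :: tau))%N by [].
  by apply: sig_min; apply/word_for_cons.
apply: PS => //; last exact: IH.
by rewrite -wE (reduced_word_length red) (reduced_word_length redv).
Qed.

(** * Reflections and length *)

Lemma reflection_gen s : S s -> reflection S s.
Proof. by move=> Ss; exists s, 1; rewrite invg1 mulg1 mul1g. Qed.

Lemma reflection_conj t g : reflection S t -> reflection S (t ^ g).
Proof.
move=> [s [h [Ss ->]]]; exists s, (g^-1 * h); split=> //.
by rewrite conjgE invgM invgK !mulgA.
Qed.

Lemma reflection_invol t : reflection S t -> t * t = 1.
Proof.
move=> [s [g [Ss ->]]].
by rewrite !mulgA mulgVK -(mulgA g) invol // mulg1 mulgV.
Qed.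

(** The cocycle [N] computes the left inversions.  If [N w t] then, along any
    word of [w], the cocycle identity exhibits [t] as a conjugate of one letter
    by the prefix before it, and multiplying by [t] deletes this letter (the
    strong exchange property).  If not, then [t] is in [N (t * w)],
    because [t] is in [N t], and the first case applies to [t * w]. *)
Lemma inversion_length :
  exists N : W -> W -> bool,
    [/\ forall s r, S s -> N s r = (r == s),
        forall u v r, N (u * v) r = N u r (+) N v (r ^ u),
        forall t w, reflection S t -> (len (t * w) < len w)%N = N w t
      & forall t w, reflection S t -> (len w < len (t * w))%N = ~~ N w t].
Proof.
have [N [Ngen NM]] := inversion_cocycle cox.
have N1 r : N 1 r = false.
  by have := NM 1 1 r; rewrite mulg1 conjg1; case: (N 1 r).
(* [r] ranges over all of [W]: being a reflection follows from [N w r]. *)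
have delete w sigma r : word_for S w sigma -> N w r ->
    exists2 tau, word_for S (r * w) tau & (size tau < size sigma)%N.
  elim: sigma w r => [|s sigma IH] w r.
    by move/word_for_nil->; rewrite N1.
  have -> : w = s * (s^-1 * w) by rewrite mulVKg.
  move: (s^-1 * w) => v /word_for_cons [Ss vsig].
  rewrite NM Ngen //; have [-> _|_ /= Nv] := eqVneq r s.
    by exists sigma => //; rewrite gen_mulK.
  have [tau vtau ltau] := IH _ _ vsig Nv; exists (s :: tau) => //.
  have -> : r * (s * v) = s * (r ^ s * v) by rewrite conjgE !mulgA mulgV mul1g.
  exact/word_for_cons.
have NV t w : N w t -> (len (t * w) < len w)%N.
  have [sigma red] := reduced_word_exists w.
  rewrite (reduced_word_length red) => /(delete _ _ _ red.1) [tau].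
  by move=> /length_le_word/leq_ltn_trans; apply.
(* With [t = g s g^-1], the contributions of [g] and [g^-1] to [N t t] cancel
   since [N (g * g^-1)] is empty; that of [s] is [N s s]. *)
have Nrefl t : reflection S t -> N t t.
  move=> [s [g [Ss tE]]]; have sE : t ^ g = s.
    by rewrite tE conjgE !mulgA mulVg mul1g mulgVK.
  have := N1 t; rewrite -(mulgV g) NM sE {2}tE NM NM !conjgM sE.
  by rewrite conjgE mulKg (Ngen s s Ss) eqxx; case: (N g t); case: (N g^-1 s).
have NnV t w : reflection S t -> ~~ N w t -> (len w < len (t * w))%N.
  move=> tR Nw; have := NV t (t * w); rewrite mulgA reflection_invol // mul1g.
  apply; rewrite NM Nrefl // conjgE mulKg; exact: Nw.
exists N; split=> // t w tR; apply/idP/idP; [|exact: NV| |exact: NnV].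
  by apply: contraLR => /(NnV _ _ tR)/ltnW; rewrite leqNgt.
by apply: contraL => /NV/ltnW; rewrite leqNgt.
Qed.

Lemma reflection_length_total t w : reflection S t ->
  (len w < len (t * w))%N = ~~ (len (t * w) < len w)%N.
Proof. by move=> tR; have [N [_ _ -> // ->]] := inversion_length. Qed.

(** Since [N (s * w)] is the symmetric difference of [{s}] and [s (N w) s], the
    reflections [t] and [t ^ s] have the same status for [w] and [s * w],
    unless [t = s]. *)
Lemma reflection_length_gen s t w : S s -> reflection S t -> t != s ->
  (len w < len (t * w))%N -> (len (s * w) < len (s * (t * w)))%N.
Proof.
move=> Ss tR t_s; have [N [Ngen NM _ Nlt]] := inversion_length.
have -> : s * (t * w) = t ^ s * (s * w).
  by rewrite conjgE genV // !mulgA -(mulgA (s * t)) invol ?mulg1.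
rewrite !Nlt //; last exact: reflection_conj.
rewrite NM (Ngen s _ Ss) -conjgM invol // conjg1.
rewrite (can2_eq (conjgK _) (conjgKV _)) conjgE mulgV mulg1 invgK.
by rewrite (negPf t_s).
Qed.

(** * The Bruhat order *)

(** Reflections may be multiplied on either side: [u * t = (u t u^-1) * u]. *)
Lemma bruhat_stepP u v : bruhat_step S u v <->
  (exists2 t, reflection S t & v = t * u) /\ (len u < len v)%N.
Proof.
split=> -[[t tR ->] lt_uv]; split=> //.
  exists (t ^ u^-1); first exact: reflection_conj.
  by rewrite conjgE invgK !mulgA mulgVK.
by exists (t ^ u); [exact: reflection_conj|rewrite conjgE mulVKg].
Qed.

Lemma bruhat_refl u : bruhat S u u. Proof. exact: rt_refl. Qed.

Lemma bruhat_trans u v w : bruhat S u v -> bruhat S v w -> bruhat S u w.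
Proof. exact: rt_trans. Qed.

Lemma bruhat_length u v : bruhat S u v -> u = v \/ (len u < len v)%N.
Proof.
elim=> {u v} [u v []|u|u v w _ IHu _ IHv]; [by right|by left|].
have [->|lt_uv] := IHu; first exact: IHv.
by have [<-|lt_vw] := IHv; right; last exact: ltn_trans lt_vw.
Qed.

Lemma bruhat_anti u v : bruhat S u v -> bruhat S v u -> u = v.
Proof.
move=> /bruhat_length [//|lt_uv] /bruhat_length [//|].
by move/(ltn_trans lt_uv); rewrite ltnn.
Qed.

Lemma bruhat_1r v : bruhat S v 1 <-> v = 1.
Proof.
split=> [/bruhat_length [//|]|->]; first by rewrite length1.
exact: bruhat_refl.
Qed.

(** * Monotone operators attached to a generator *)

Definition raise (s u : W) : W := if (len u < len (s * u))%N then s * u else u.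

Definition lower (s u : W) : W := if (len (s * u) < len u)%N then s * u else u.

Variant descent_spec (s u : W) : W -> W -> Prop :=
  | Ascent of (len u < len (s * u))%N & bruhat_step S u (s * u) :
      descent_spec s u (s * u) u
  | Descent of (len (s * u) < len u)%N & bruhat_step S (s * u) u :
      descent_spec s u u (s * u).

Lemma descentP s u : S s -> descent_spec s u (raise s u) (lower s u).
Proof.
move=> Ss; have sR := reflection_gen Ss.
have total := reflection_length_total u sR.
rewrite /raise /lower total; case: ifPn => lt_u.
  case: ifPn => [lt_u'|_]; first by rewrite lt_u' in lt_u.
  constructor; rewrite ?total //.
  by apply/bruhat_stepP; rewrite total; split=> //; exists s.
case: ifPn => [lt_u'|]; last by rewrite (negPn lt_u).
constructor=> //; apply/bruhat_stepP; split=> //.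
by exists s; rewrite ?gen_mulK.
Qed.

Lemma raise_ge s u : S s ->
  bruhat S u (raise s u) /\ bruhat S (s * u) (raise s u).
Proof.
move=> Ss; case: (descentP u Ss) => _ step; split;
  by [exact: bruhat_refl|exact: rt_step].
Qed.

Lemma lower_le s u : S s ->
  bruhat S (lower s u) u /\ bruhat S (lower s u) (s * u).
Proof.
move=> Ss; case: (descentP u Ss) => _ step; split;
  by [exact: bruhat_refl|exact: rt_step].
Qed.

Lemma raise_lower_mul s u : S s ->
  raise s (s * u) = raise s u /\ lower s (s * u) = lower s u.
Proof.
move=> Ss; rewrite /raise /lower gen_mulK //.
have := reflection_length_total u (reflection_gen Ss).
by case: ltngtP.
Qed.

Lemma raise_idem s u : S s -> raise s (raise s u) = raise s u.
Proof.
move=> Ss; rewrite {2}/raise; case: ifP => // _.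
by rewrite (raise_lower_mul u Ss).1.
Qed.

(** For a single Bruhat step [v = t * u]: if [t = s] then [u] and [v] have the
    same images; otherwise [s * u] is below [s * v] as well, and the longer
    (resp. shorter) elements of the two pairs are compared through one of
    these two relations. *)
Lemma raise_lower_homo s u v : S s -> bruhat S u v ->
  bruhat S (raise s u) (raise s v) /\ bruhat S (lower s u) (lower s v).
Proof.
move=> Ss; elim=> {u v} [u v step|u|u v w _ [IHu IHu'] _ [IHv IHv']].
- move/bruhat_stepP: (step) => -[[t tR vE] lt_uv].
  have [ts|t_s] := eqVneq t s.
    rewrite vE ts; have [-> ->] := raise_lower_mul u Ss.
    by split; exact: bruhat_refl.
  have step_s : bruhat_step S (s * u) (s * v).
    apply/bruhat_stepP; split; last first.
      by rewrite vE; apply: reflection_length_gen => //; rewrite -vE.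
    exists (t ^ s); first exact: reflection_conj.
    by rewrite vE conjgE genV // !mulgA -(mulgA (s * t)) invol ?mulg1.
  split.
    case: (descentP u Ss) => _ _.
      exact: bruhat_trans (rt_step _ _ _ _ step_s) (raise_ge v Ss).2.
    exact: bruhat_trans (rt_step _ _ _ _ step) (raise_ge v Ss).1.
  case: (descentP v Ss) => _ _.
    exact: bruhat_trans (lower_le u Ss).1 (rt_step _ _ _ _ step).
  exact: bruhat_trans (lower_le u Ss).2 (rt_step _ _ _ _ step_s).
- by split; exact: bruhat_refl.
- by split; [exact: bruhat_trans IHv|exact: bruhat_trans IHv'].
Qed.

(** The lifting property.  Applying [lower s] to [v <= s * w] gives the direct
    implication, applying [raise s] to [s * v <= w] the converse one. *)
Lemma lower_interval_mul s w v : S s -> (len w < len (s * w))%N ->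
  bruhat S v (s * w) <-> bruhat S v w \/ bruhat S (s * v) w.
Proof.
move=> Ss lt_w.
have [swE wE] : raise s w = s * w /\ lower s (s * w) = w.
  by rewrite /raise /lower gen_mulK // lt_w.
split=> [/(raise_lower_homo Ss) []|].
  by rewrite wE /lower => _; case: ifP; [right|left].
rewrite -swE => -[le_w|].
  exact: bruhat_trans le_w (raise_ge w Ss).1.
move/(raise_lower_homo Ss) => -[+ _]; apply: bruhat_trans.
by have := (raise_ge (s * v) Ss).2; rewrite gen_mulK.
Qed.

(** * Extrema of shifted lower intervals *)

Local Notation shifted := (shifted_lower_interval S).

Lemma shifted1 x y : shifted 1 x y <-> y = x^-1.
Proof.
split=> [[v /bruhat_1r -> <-]|->]; first by rewrite mul1g.
by exists 1; rewrite ?mul1g //; apply/bruhat_1r.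
Qed.

Lemma shifted_mul s w x y : S s -> (len w < len (s * w))%N ->
  shifted (s * w) x y <-> shifted w x y \/ shifted w x (s * y).
Proof.
move=> Ss lt_w; split.
  case=> v /= /(lower_interval_mul _ Ss lt_w) [le_v|le_v] <-.
    by left; exists v.
  by right; exists (s * v); rewrite ?mulgA.
case=> -[v /= le_v vE].
  by exists v => //=; apply/(lower_interval_mul _ Ss lt_w); left.
exists (s * v); last by rewrite -mulgA vE gen_mulK.
by apply/(lower_interval_mul _ Ss lt_w); right; rewrite gen_mulK.
Qed.

Lemma shifted_minimum w sigma x : reduced_word S w sigma ->
  is_minimum S (shifted w x) (foldr lower x^-1 sigma).
Proof.
move: w sigma; apply: reduced_word_ind => [|s w sigma Ss lt_w _ [/= Am minm]].
  by split=> [|b]; [apply/shifted1|move/shifted1->; exact: bruhat_refl].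
split=> [|b /(shifted_mul _ _ Ss lt_w) Ab].
  apply/(shifted_mul _ _ Ss lt_w) => /=.
  by case: (descentP _ Ss) => _ _; [left|right; rewrite gen_mulK].
have lower_min c : shifted w x c ->
    bruhat S (lower s (foldr lower x^-1 sigma)) (lower s c).
  by move=> Ac; apply: (raise_lower_homo Ss (minm _ Ac)).2.
apply: bruhat_trans (lower_le b Ss).1.
by case: Ab => /lower_min //; rewrite (raise_lower_mul b Ss).2.
Qed.

Lemma shifted_maximum w sigma x : reduced_word S w sigma ->
  is_maximum S (shifted w x) (foldr raise x^-1 sigma).
Proof.
move: w sigma; apply: reduced_word_ind => [|s w sigma Ss lt_w _ [/= Am maxm]].
  by split=> [|b]; [apply/shifted1|move/shifted1->; exact: bruhat_refl].
split=> [|b /(shifted_mul _ _ Ss lt_w) Ab].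
  apply/(shifted_mul _ _ Ss lt_w) => /=.
  by case: (descentP _ Ss) => _ _; [right; rewrite gen_mulK|left].
have raise_max c : shifted w x c ->
    bruhat S (raise s c) (raise s (foldr raise x^-1 sigma)).
  by move=> Ac; apply: (raise_lower_homo Ss (maxm _ Ac)).1.
apply: bruhat_trans (raise_ge b Ss).1 _.
by case: Ab => /raise_max //; rewrite (raise_lower_mul b Ss).1.
Qed.

Lemma minimum_unique (A : set W) a :
  is_minimum S A a -> unique (is_minimum S A) a.
Proof.
move=> minA; split=> // b minB; apply: bruhat_anti.
  exact: minA.2 minB.1.
exact: minB.2 minA.1.
Qed.

Lemma maximum_unique (A : set W) a :
  is_maximum S A a -> unique (is_maximum S A) a.
Proof.
move=> maxA; split=> // b maxB; apply: bruhat_anti.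
  exact: maxB.2 maxA.1.
exact: maxA.2 maxB.1.
Qed.

(** * The opposite Demazure operator *)

(** Inversion turns the right operators into left ones and the leftmost letter,
    which acts first in [foldl], into the rightmost one. *)
Lemma op_demazure_wordV u tau : (forall s, s \in tau -> S s) ->
  (op_demazure_word S u tau)^-1 = foldr lower u^-1 (rev tau).
Proof.
elim: tau u => [//|s tau IH] u Stau; rewrite rev_cons foldr_rcons /=.
have Ss : S s by apply: Stau; rewrite inE eqxx.
rewrite /= -/(op_demazure_word S _ tau) IH; last first.
  by move=> r rt; apply: Stau; rewrite inE rt orbT.
congr foldr; rewrite /op_demazure_gen /lower.
have -> : s * u^-1 = (u * s)^-1 by rewrite invgM (genV Ss).
by rewrite !lengthV; case: ifP.
Qed.

(** The value on a reduced word is the inverse of a minimum, which is unique;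
    this is why it does not depend on the word. *)
Lemma op_demazure_minimum w x :
  is_minimum S (shifted w x) (op_demazure S x w^-1)^-1.
Proof.
have [sigma red] := reduced_word_exists w.
have word_min tau : reduced_word S w^-1 tau ->
    is_minimum S (shifted w x) (op_demazure_word S x tau)^-1.
  move=> redV; rewrite op_demazure_wordV; last exact: redV.1.1.
  apply: shifted_minimum; rewrite -(invgK w); exact: reduced_word_rev.
have redV := reduced_word_rev red.
have common tau : reduced_word S w^-1 tau ->
    op_demazure_word S x tau = op_demazure_word S x (rev sigma).
  move=> redtau; apply: invg_inj.
  exact/esym/(minimum_unique (word_min _ redV)).2/word_min.
suff <- : op_demazure_word S x (rev sigma) = op_demazure S x w^-1.
  exact: word_min.
have choice_ok := @xgetPex _ x
  [set v | forall tau, reduced_word S w^-1 tau ->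
             op_demazure_word S x tau = v]%classic.
by apply: choice_ok redV; exists (op_demazure_word S x (rev sigma)).
Qed.

(** * The Demazure product *)

(** A word-free formula for the Demazure product. *)
Definition interval_max (u v : W) : W := xget 1 (is_maximum S (shifted u v^-1)).

Lemma interval_max_word u sigma v : reduced_word S u sigma ->
  interval_max u v = foldr raise v sigma.
Proof.
move=> /(@shifted_maximum u sigma v^-1); rewrite invgK => maxu.
apply: xget_unique => // y maxy; exact/esym/(maximum_unique maxu).2.
Qed.

(** If [s] is an ascent of [u], prepend [s] to a reduced word of [u]; otherwise
    [u = s * (s * u)] with [s] an ascent of [s * u], and [raise s] is
    idempotent. *)
Lemma interval_max_raise s u v : S s ->
  interval_max (raise s u) v = raise s (interval_max u v).
Proof.
move=> Ss; have cons_case w : (len w < len (s * w))%N ->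
    interval_max (s * w) v = raise s (interval_max w v).
  move=> lt_w; have [sigma red] := reduced_word_exists w.
  have reds := reduced_word_cons Ss lt_w red.
  by rewrite (interval_max_word _ red) (interval_max_word _ reds).
case: (descentP u Ss) => lt_u _; first exact: cons_case.
by rewrite -(gen_mulK Ss u) cons_case ?raise_idem // gen_mulK.
Qed.

Lemma interval_max_1l v : interval_max 1 v = v.
Proof.
apply: (@interval_max_word 1 [::]); split; first exact/word_for_nil.
by [].
Qed.

Lemma interval_max_gen s v : S s -> interval_max s v = raise s v.
Proof.
move=> Ss; rewrite -{2}(interval_max_1l v) -interval_max_raise //.
congr interval_max.
by case: (descentP 1 Ss) => [_ _|]; rewrite ?mulg1 // length1.
Qed.

(** Associativity follows by induction on the first factor, as [interval_max]
    commutes with [raise s] in that factor. *)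
Lemma is_demazure_interval_max : is_demazure S interval_max.
Proof.
split.
- move=> u v w; have [sigma red] := reduced_word_exists u.
  elim/reduced_word_ind: u sigma / red => [|s u sigma Ss lt_u _ IH].
    by rewrite !interval_max_1l.
  have <- : raise s u = s * u by rewrite /raise lt_u.
  by rewrite !interval_max_raise // IH.
- exact: interval_max_1l.
- move=> u; have [sigma red] := reduced_word_exists u.
  elim/reduced_word_ind: u sigma / red => [|s u sigma Ss lt_u _ IH].
    exact: interval_max_1l.
  have <- : raise s u = s * u by rewrite /raise lt_u.
  by rewrite !interval_max_raise // IH.
- move=> s w Ss; rewrite interval_max_gen // /raise.
  by split; case: ltngtP.
Qed.

(** Any product satisfying the axioms takes this value, so that the one selected
    by choice does. *)
Lemma demazure_word w sigma v : reduced_word S w sigma ->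
  demazure S w v = foldr raise v sigma.
Proof.
have [mulA mul1 _ mulgen] : is_demazure S (demazure S).
  by apply: xgetPex; exists interval_max; exact: is_demazure_interval_max.
move: w sigma; apply: reduced_word_ind => [|s w sigma Ss lt_w _ IH].
  exact: mul1.
have <- : demazure S s w = s * w by apply: (mulgen s w Ss).2.
rewrite -mulA IH /=; case: (descentP _ Ss) => lt_s _.
  exact: (mulgen _ _ Ss).2.
exact: (mulgen _ _ Ss).1.
Qed.

Lemma demazure_maximum w x : is_maximum S (shifted w x) (demazure S w x^-1).
Proof.
have [sigma red] := reduced_word_exists w.
by rewrite (demazure_word _ red); apply: shifted_maximum.
Qed.

End CoxeterSystem.

(** * Minimum and maximum *)

Theorem corollary4p10 (W : groupType) (S : set W) (w x : W) :
  coxeter_system S ->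
  unique (is_minimum S (shifted_lower_interval S w x))
         (op_demazure S x w^-1)^-1 /\
  unique (is_maximum S (shifted_lower_interval S w x))
         (demazure S w x^-1).
Proof.
move=> cox; split.
  exact/minimum_unique/op_demazure_minimum.
exact/maximum_unique/demazure_maximum.
Qed.
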